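(* There is a universal constant $C>0$ such that the following holds for any $0<\varepsilon\le1$. Write $\Phi(x)=C\,x\,\log^C(e+x)$ for $x\ge0$. Let $n\ge1$, let $\mathcal{X}=\mathcal{X}_1\times\cdots\times\mathcal{X}_n$ be a product of finite state spaces and let $\pi$ be any probability distribution on $\mathcal{X}$. Then $$t^{\mathsf{GD}}_{\mathsf{mix}}(\varepsilon)\le\max_\sigma\,\Phi\left(n^4\,\bigl(t^{\mathsf{SS}(\sigma)}_{\mathsf{mix}}(1/10)\bigr)^4\right)\cdot\log\left(\frac{1}{\varepsilon\pi_{\min}}\right)$$ and $$t^{\mathsf{GD}}_{\mathsf{mix}}(\varepsilon)\le\min_\sigma\,\Phi\left(n^6\,\bigl(t^{\mathsf{SS}(\sigma)}_{\mathsf{mix}}(1/10)\bigr)^4\right)\cdot\log\left(\frac{1}{\varepsilon\pi_{\min}}\right),$$ where $\sigma$ ranges over all permutations of $[n]$ and $\pi_{\min}:=\min_{x\in\mathcal{X}:\pi(x)\ne0}\pi(x)$.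
   Context: Notation: $[n]=\{1,\dots,n\}$. For $i\in[n]$, $\mathsf{P}_i$ is the Markov kernel that rerandomizes the $i$-th coordinate according to the conditional distribution of $\pi$ given all other coordinates; it acts on functions by $\mathsf{P}_i f(x)=\mathbb{E}_{X\sim\pi}[f(X)\mid X_{-i}=x_{-i}]$, where $x_{-i}$ is the restriction of $x$ to the coordinates other than $i$. All chains are considered on the support $\{x:\pi(x)\neq 0\}$ of $\pi$. Glauber dynamics has transition matrix $\mathsf{P}_{\mathsf{GD}}=\frac1n\sum_{i=1}^n\mathsf{P}_i$. The systematic scan with order $\sigma$ has transition matrix $\mathsf{P}_\sigma=\mathsf{P}_{\sigma(n)}\cdots\mathsf{P}_{\sigma(1)}$; one step of this chain is a full round of $n$ site updates. Total variation distance: $d_{\mathsf{TV}}(\mu,\nu)=\frac12\sum_x|\mu(x)-\nu(x)|$. For a transition matrix $\mathsf{P}$ with stationary distribution $\pi$, the mixing time is $t^{\mathsf{P}}_{\mathsf{mix}}(\varepsilon)=\min\{t\ge 0:\max_x d_{\mathsf{TV}}(\mathsf{P}^t(x,\cdot),\pi)\le\varepsilon\}$, the maximum being over the support of $\pi$, with value $\infty$ if no such $t$ exists (inequalities with infinite right-hand side are regarded as trivially true). $t^{\mathsf{GD}}_{\mathsf{mix}}$ and $t^{\mathsf{SS}(\sigma)}_{\mathsf{mix}}$ denote the mixing times of $\mathsf{P}_{\mathsf{GD}}$ and $\mathsf{P}_\sigma$. *)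

(* Defs.v *)
From HB Require Import structures.
From mathcomp Require Import all_boot all_order all_algebra all_fingroup.
From mathcomp Require Import all_classical all_reals all_analysis.

Set Implicit Arguments.
Unset Strict Implicit.
Unset Printing Implicit Defensive.

Import Order.TTheory GRing.Theory Num.Theory.
Local Open Scope ring_scope.

(* Transition matrices on a finite state space S are square matrices of size
   #|S|, the state x corresponding to the index enum_rank x. *)

Definition dTV (R : realType) (S : finType) (mu nu : S -> R) : R :=
  2^-1 * \sum_(x : S) `|mu x - nu x|.

(* max_x dTV (P^t(x, .), pi) <= eps ; distances are nonnegative, so 0 is a
   neutral starting value for the maximum. *)
Definition mixed (R : realType) (S : finType) (pi : S -> R) (P : 'M[R]_#|S|)
    (eps : R) (t : nat) : bool :=
  \big[Num.max/0]_(x : S)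
    dTV (fun y => (P ^+ t) (enum_rank x) (enum_rank y)) pi <= eps.

Definition mixing_time (R : realType) (S : finType) (pi : S -> R)
    (P : 'M[R]_#|S|) (eps : R) : \bar R :=
  if pselect (exists t, mixed pi P eps t) is left h
  then ((ex_minn h)%:R)%:E else +oo%E.

Definition supp (R : realType) (T : finType) (pi : T -> R) : finType :=
  {x : T | pi x != 0}.

Definition supp_distr (R : realType) (T : finType) (pi : T -> R) :
    supp pi -> R := fun x => pi (val x).

(* Every value of a distribution is at most 1, so 1 is a neutral starting value
   for the minimum over the (nonempty) support. *)
Definition pi_min (R : realType) (T : finType) (pi : T -> R) : R :=
  \big[Num.min/1]_(x : T | pi x != 0) pi x.

Section Chains.
Variables (R : realType) (n : nat) (X : 'I_n -> finType).
Local Notation config := {dffun forall i : 'I_n, X i}.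
Variable pi : config -> R.

Definition agree_off (i : 'I_n) (x y : config) : bool :=
  [forall j : 'I_n, (j != i) ==> (x j == y j)].

(* P_i(x, y) = Pr_pi[X = y | X_{-i} = x_{-i}]; the denominator is positive
   because it includes pi x, for x in the support. *)
Definition site_update (i : 'I_n) : 'M[R]_#|supp pi| :=
  \matrix_(a, b)
    let x : config := val (enum_val a : supp pi) in
    let y : config := val (enum_val b : supp pi) in
    if agree_off i x y then pi y / \sum_(z : config | agree_off i x z) pi z
    else 0.

Definition glauber : 'M[R]_#|supp pi| :=
  n%:R^-1 *: \sum_(i < n) site_update i.

(* rev_ord puts the factors in the order P_{s(n)} ... P_{s(1)}. *)
Definition systematic_scan (s : 'S_n) : 'M[R]_#|supp pi| :=
  \prod_(k < n) site_update (s (rev_ord k)).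

Definition tmix_GD (eps : R) : \bar R :=
  mixing_time (supp_distr (pi := pi)) glauber eps.

Definition tmix_SS (s : 'S_n) (eps : R) : \bar R :=
  mixing_time (supp_distr (pi := pi)) (systematic_scan s) eps.

End Chains.

Definition Phi (R : realType) (C x : R) : R :=
  C * x * (ln (expR 1 + x) `^ C).

(* Phi extended to infinite arguments by Phi(+oo) = +oo. *)
Definition ePhi (R : realType) (C : R) : \bar R -> \bar R := er_map (Phi C).

(* Main.v *)
Require Import Defs.
From HB Require Import structures.
From mathcomp Require Import all_boot all_order all_algebra all_fingroup.
From mathcomp Require Import all_classical all_reals all_analysis.
From mathcomp Require Import ring lra.

Set Implicit Arguments.
Unset Strict Implicit.
Unset Printing Implicit Defensive.

Import Order.TTheory GRing.Theory Num.Theory.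
Local Open Scope ring_scope.

(** Every single scan order controls Glauber dynamics: if the scan mixes to
    distance 1/10 in T rounds, then the Glauber chain P satisfies a Poincare
    inequality with constant 100 (n T)^2. That is stronger than both bounds of
    the theorem, whose right-hand sides are n^4 T^4 and n^6 T^4 up to
    logarithms, so maximum and minimum over the orders are treated alike.

    The two chains are compared through the mean displacement
    J(K, u) = E |u(X_0) - u(X_1)| of a stationary step of a kernel K. By the
    triangle inequality J is subadditive under composition of kernels that
    share the stationary law [displacementM]; T rounds of a scan use each site
    update T times, so J(scan^T, u) <= T sum_i J(P_i, u) = n T J(P, u).

    For the Poincare inequality [mixing_poincare], centre f at a median, call
    the result F, and take u = F |F|. The median makes both {u <= 0} and
    {u >= 0} have mass at least 1/2; after T rounds the scan therefore reaches
    the side opposite to its starting point with probability at least 3/10,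
    wherever it starts, whence J(scan^T, u) >= 3/10 E F^2 [displacement_ge].
    On the other hand |u(x) - u(y)| <= |F(x) - F(y)| (|F(x)| + |F(y)|), so
    J(P, u) is at most a E(F) + (2/a) E F^2 for every a > 0, where E(F) is the
    Dirichlet form [displacement_signed_square]. The choice a = 10 n T absorbs
    the last term. This is Cheeger's argument, run on functions instead of sets.

    As a mean of orthogonal projections, P satisfies |P f|^2 <= <f, P f>
    [norm_projection_mean], so the Poincare inequality with constant k gives
    Var (P^t f) <= (1 - 1/k)^t Var f [variance_contraction]. Testing against
    the sign of P^t(x, .) - pi turns this into
    pi(x) dTV(P^t(x, .), pi)^2 <= (1 - 1/k)^t / 4 [tv_le_variance], and
    t = floor (2 k log (1 / (eps pi_min))) steps suffice. *)

(** * Kernels with a common stationary law *)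

Section Kernels.
Variables (R : realFieldType) (m : nat) (w : 'I_m -> R).
Implicit Types (M A B P : 'M[R]_m) (f g u : 'I_m -> R).

Definition stationary_kernel M :=
  [/\ forall x y, 0 <= M x y, forall x, \sum_y M x y = 1
    & forall y, \sum_x w x * M x y = w y].

(** The mean of |u(X_0) - u(X_1)| over a step of M started from w, provided
    that M is a kernel with stationary law w. *)
Definition displacement M u := \sum_x \sum_y w x * M x y * `|u x - u y|.

Definition dirichlet M f := 2^-1 * \sum_x \sum_y w x * M x y * (f x - f y) ^+ 2.

Definition apply_kernel M f : 'I_m -> R := fun x => \sum_y M x y * f y.

Hypothesis w0 : forall x, 0 < w x.

Lemma stationary_kernel1 : stationary_kernel 1%:M.
Proof.
split=> [x y|x|y]; first by rewrite mxE ler0n.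
- rewrite (bigD1 x) //= mxE eqxx big1 ?addr0 // => y yx.
  by rewrite mxE eq_sym (negPf yx).
- rewrite (bigD1 y) //= mxE eqxx mulr1 big1 ?addr0 // => x xy.
  by rewrite mxE (negPf xy) mulr0.
Qed.

Lemma stationary_kernelM A B :
  stationary_kernel A -> stationary_kernel B -> stationary_kernel (A *m B).
Proof.
move=> [A0 A1 Aw] [B0 B1 Bw]; split=> [x y|x|y].
- by rewrite mxE sumr_ge0 // => z _; rewrite mulr_ge0.
- under eq_bigr do rewrite mxE.
  rewrite exchange_big -[RHS](A1 x); apply: eq_bigr => z _.
  by rewrite -mulr_sumr B1 mulr1.
- under eq_bigr do rewrite mxE mulr_sumr.
  rewrite exchange_big -[RHS]Bw; apply: eq_bigr => z _ /=.
  by rewrite -Aw mulr_suml; apply: eq_bigr => x _; rewrite mulrA.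
Qed.

Lemma stationary_kernel_prod (I : Type) (r : seq I) (A : I -> 'M[R]_m) :
  (forall i, stationary_kernel (A i)) ->
  stationary_kernel (\prod_(i <- r) A i).
Proof.
move=> kA; apply: big_ind => //; first exact: stationary_kernel1.
exact: stationary_kernelM.
Qed.

Lemma stationary_kernelX A t :
  stationary_kernel A -> stationary_kernel (A ^+ t).
Proof.
move=> kA; elim: t => [|t IH]; first exact: stationary_kernel1.
by rewrite exprS; apply: stationary_kernelM.
Qed.

Lemma displacement1 u : displacement 1%:M u = 0.
Proof.
rewrite /displacement big1 // => x _; rewrite big1 // => y _.
rewrite mxE; case: eqVneq => [->|_]; first by rewrite subrr normr0 mulr0.
by rewrite mulr0 mul0r.
Qed.

(** A step of A *m B is a step of A followed by a step of B. The path from x to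
    y through the intermediate point z is controlled by the triangle
    inequality, and z is again distributed as w because A preserves w. *)
Lemma displacementM A B u : stationary_kernel A -> stationary_kernel B ->
  displacement (A *m B) u <= displacement A u + displacement B u.
Proof.
move=> [A0 A1 Aw] [B0 B1 Bw].
have -> : displacement A u =
    \sum_x \sum_y \sum_z w x * A x z * B z y * `|u x - u z|.
  apply: eq_bigr => x _; rewrite exchange_big; apply: eq_bigr => z _ /=.
  by rewrite -mulr_suml -mulr_sumr B1 mulr1.
have -> : displacement B u =
    \sum_x \sum_y \sum_z w x * A x z * B z y * `|u z - u y|.
  under [RHS]eq_bigr do rewrite exchange_big.
  rewrite exchange_big /=; apply: eq_bigr => z _; rewrite exchange_big /=.
  apply: eq_bigr => y _; rewrite -2!mulr_suml Aw //.
rewrite -big_split; apply: ler_sum => x _ /=.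
rewrite -big_split; apply: ler_sum => y _ /=.
rewrite -big_split mxE mulr_sumr mulr_suml; apply: ler_sum => z _ /=.
rewrite mulrA -mulrDr; apply: ler_wpM2l; last exact: ler_distD.
by rewrite !mulr_ge0 // ltW.
Qed.

Lemma displacement_prod (I : Type) (r : seq I) (A : I -> 'M[R]_m) u :
  (forall i, stationary_kernel (A i)) ->
  displacement (\prod_(i <- r) A i) u <= \sum_(i <- r) displacement (A i) u.
Proof.
move=> kA; elim: r => [|i r IH]; first by rewrite !big_nil displacement1.
rewrite !big_cons; apply: le_trans (displacementM _ _ _) _ => //.
  exact: stationary_kernel_prod.
by rewrite lerD2l.
Qed.

Lemma displacementX A t u : stationary_kernel A ->
  displacement (A ^+ t) u <= t%:R * displacement A u.
Proof.
move=> kA; elim: t => [|t IH]; first by rewrite displacement1 mul0r.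
rewrite exprS -natr1 mulrDl mul1r addrC.
apply: le_trans (displacementM _ kA (stationary_kernelX t kA)) _.
by rewrite lerD2l.
Qed.

Lemma stationary_kernel_mean n (A : 'I_n -> 'M[R]_m) : (0 < n)%N ->
  (forall i, stationary_kernel (A i)) ->
  stationary_kernel (n%:R^-1 *: \sum_i A i).
Proof.
move=> n0 kA; have nR : n%:R != 0 :> R by rewrite pnatr_eq0 -lt0n.
have mean (c : R) : n%:R^-1 * (\sum_(i < n) c) = c.
  by rewrite sumr_const card_ord -[c *+ n]mulr_natl mulKf.
split=> [x y|x|y].
- rewrite !mxE summxE mulr_ge0 ?invr_ge0 // sumr_ge0 // => i _.
  by have [] := kA i.
- under eq_bigr do rewrite mxE summxE.
  rewrite -mulr_sumr exchange_big -[RHS]mean; congr (_ * _).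
  by apply: eq_bigr => i _; have [] := kA i.
- under eq_bigr do rewrite mxE summxE mulrCA mulr_sumr.
  rewrite -mulr_sumr exchange_big -[RHS]mean; congr (_ * _).
  by apply: eq_bigr => i _; have [] := kA i.
Qed.

Lemma displacement_mean n (A : 'I_n -> 'M[R]_m) u :
  displacement (n%:R^-1 *: \sum_i A i) u = n%:R^-1 * \sum_i displacement (A i) u.
Proof.
rewrite /displacement [X in _ * X]exchange_big mulr_sumr; apply: eq_bigr => x _.
rewrite [X in _ * X]exchange_big mulr_sumr; apply: eq_bigr => y _ /=.
rewrite !mxE summxE !mulr_sumr mulr_suml.
by apply: eq_bigr => i _; ring.
Qed.

(** * From displacement to a Poincare inequality *)

Hypothesis w1 : \sum_x w x = 1.

(** A median is the smallest value c of f with w (f <= c) >= 1/2: if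
    w (f < c) exceeded 1/2, the next lower value of f would qualify too. *)
Lemma ex_median f : exists c,
  2^-1 <= \sum_(x | f x <= c) w x /\ 2^-1 <= \sum_(x | c <= f x) w x.
Proof.
have /card_gt0P [i0 _] : (0 < #|'I_m|)%N.
  case: m w w1 => [|k] v; last by rewrite card_ord.
  by rewrite big_ord0 => /eqP; rewrite eq_sym oner_eq0.
pose P x := 2^-1 <= \sum_(y | f y <= f x) w y.
have [xM _ maxM] := @Order.TotalTheory.arg_maxP _ R _ i0 xpredT f isT.
have PM : P xM.
  rewrite /P (eq_bigl xpredT) ?w1 ?invf_le1 ?ler1n //.
  by move=> y; apply: (maxM y isT).
have [x Px minx] := @Order.TotalTheory.arg_minP _ R _ xM P f PM.
exists (f x); split=> //.
have split_w : \sum_(y | f x <= f y) w y = 1 - \sum_(y | f y < f x) w y.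
  apply: (canRL (addrK _)); rewrite -w1 [RHS](bigID (fun y => f y < f x)) addrC /=.
  by congr (_ + _); apply: eq_bigl => y; rewrite ltNge negbK.
rewrite split_w; suff: \sum_(y | f y < f x) w y <= 2^-1 by move=> h; lra.
case: (pickP (fun y => f y < f x)) => [y0 y0x|none]; last first.
  by rewrite big_pred0 // invr_ge0.
have [y yx maxy] := @Order.TotalTheory.arg_maxP _ R _ y0 (fun y => f y < f x) f y0x.
rewrite (eq_bigl (fun z => f z <= f y)); last first.
  move=> z; apply/idP/idP => [/maxy //|]; by move/le_lt_trans; apply.
rewrite leNgt; apply/negP => h.
have /minx : P y by apply: ltW.
by rewrite leNgt yx.
Qed.

Lemma kernel_mass_ge M (Q : pred 'I_m) x (d : R) :
  \sum_y `|M x y - w y| <= d ->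
  \sum_(y | Q y) w y - d <= \sum_(y | Q y) M x y.
Proof.
move=> hd; rewrite lerBlDr -lerBlDl -sumrB; apply: le_trans hd.
rewrite [leRHS](bigID Q) /= -[leLHS]addr0 lerD //; last exact: sumr_ge0.
by apply: ler_sum => y _; rewrite distrC ler_norm.
Qed.

(** From a point with u x >= 0, a step of M lands in {u <= 0} with probability
    at least 1/2 - 1/5, and such a step moves u by at least |u x|;
    symmetrically for u x <= 0. *)
Lemma displacement_ge M u : stationary_kernel M ->
  (forall x, \sum_y `|M x y - w y| <= 5^-1) ->
  2^-1 <= \sum_(x | u x <= 0) w x -> 2^-1 <= \sum_(x | 0 <= u x) w x ->
  3 / 10 * \sum_x w x * `|u x| <= displacement M u.
Proof.
move=> [M0 _ _] hM lo hi; rewrite mulr_sumr; apply: ler_sum => x _.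
have half (Q : pred 'I_m) : 2^-1 <= \sum_(y | Q y) w y ->
    (forall y, Q y -> `|u x| <= `|u x - u y|) ->
    3 / 10 * (w x * `|u x|) <= \sum_y w x * M x y * `|u x - u y|.
  move=> hQ far; have massQ := kernel_mass_ge Q (hM x).
  rewrite (bigID Q) /= -[leLHS]addr0 lerD //; last first.
    by apply: sumr_ge0 => y _; rewrite !mulr_ge0 // ltW.
  apply: le_trans (_ : \sum_(y | Q y) w x * M x y * `|u x| <= _); last first.
    by apply: ler_sum => y /far; apply: ler_wpM2l; rewrite mulr_ge0 // ltW.
  rewrite -mulr_suml -mulr_sumr mulrA; apply: ler_wpM2r => //.
  by rewrite mulrC ler_pM2l //; lra.
have [ux|ux] := leP 0 (u x).
- apply: (half _ lo) => y uy; rewrite ger0_norm // ger0_norm ?subr_ge0; lra.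
- apply: (half _ hi) => y uy; rewrite ltr0_norm // ler0_norm; lra.
Qed.

(** The left-hand side is at most |s - t| (|s| + |t|): with equality if s and t
    have the same sign, and since s^2 + t^2 <= (|s| + |t|)^2 otherwise. Then
    split the product by the weighted arithmetic-geometric mean inequality. *)
Lemma signed_square_lipschitz (a s t : R) : 0 < a ->
  `|s * `|s| - t * `|t| | <= a / 2 * (s - t) ^+ 2 + a^-1 * (s ^+ 2 + t ^+ 2).
Proof.
move=> a0.
apply: le_trans (_ : `|s - t| * (`|s| + `|t|) <= _).
  have [s0|s0] := leP 0 s; have [t0|t0] := leP 0 t;
  have [st|st] := leP 0 (s - t); rewrite ler_norml;
  rewrite ?(ger0_norm s0) ?(ltr0_norm s0) ?(ger0_norm t0) ?(ltr0_norm t0);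
  rewrite ?(ger0_norm st) ?(ltr0_norm st); apply/andP; split; nra.
(* The defect of the inequality is a positive multiple of a sum of two squares. *)
have -> : a / 2 * (s - t) ^+ 2 + a^-1 * (s ^+ 2 + t ^+ 2) =
    `|s - t| * (`|s| + `|t|) + a^-1 / 2 *
      ((a * `|s - t| - (`|s| + `|t|)) ^+ 2 + (`|s| - `|t|) ^+ 2).
  rewrite -(real_normK (num_real (s - t))) -(real_normK (num_real s)).
  rewrite -(real_normK (num_real t)); field; lra.
rewrite lerDl; apply: mulr_ge0; last by rewrite addr_ge0 // sqr_ge0.
by rewrite divr_ge0 // invr_ge0 ltW.
Qed.

Lemma sum_step_source M f : stationary_kernel M ->
  \sum_x w x * f x = \sum_x \sum_y w x * M x y * f x.
Proof.
move=> [_ M1 _]; apply: eq_bigr => x _.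
by rewrite -mulr_suml -mulr_sumr M1 mulr1.
Qed.

Lemma sum_step_target M f : stationary_kernel M ->
  \sum_x w x * f x = \sum_x \sum_y w x * M x y * f y.
Proof.
move=> [_ _ Mw]; rewrite exchange_big; apply: eq_bigr => y _ /=.
by rewrite -mulr_suml Mw.
Qed.

(** Each step pays for both of its endpoints, and both are distributed as w:
    this is the factor 2 in 2 / a. *)
Lemma displacement_signed_square M f (a : R) : stationary_kernel M -> 0 < a ->
  displacement M (fun x => f x * `|f x|) <=
    a * dirichlet M f + 2 / a * \sum_x w x * f x ^+ 2.
Proof.
move=> kM a0.
have lhs := sum_step_source (fun x => f x ^+ 2) kM.
have rhs := sum_step_target (fun x => f x ^+ 2) kM.
have -> : 2 / a * \sum_x w x * f x ^+ 2 =
    a^-1 * \sum_x \sum_y w x * M x y * (f x ^+ 2 + f y ^+ 2).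
  have -> : \sum_x \sum_y w x * M x y * (f x ^+ 2 + f y ^+ 2) =
      2 * \sum_x w x * f x ^+ 2.
    rewrite mulrDl mul1r {1}lhs rhs -big_split; apply: eq_bigr => x _ /=.
    by rewrite -big_split; apply: eq_bigr => y _; rewrite mulrDr.
  by rewrite mulrCA mulrA.
rewrite /dirichlet mulrA !mulr_sumr -big_split; apply: ler_sum => x _ /=.
rewrite !mulr_sumr -big_split; apply: ler_sum => y _ /=.
rewrite [leRHS](_ : _ = w x * M x y *
    (a / 2 * (f x - f y) ^+ 2 + a^-1 * (f x ^+ 2 + f y ^+ 2))); last by ring.
have [M0 _ _] := kM; apply: ler_wpM2l; first by rewrite mulr_ge0 // ltW.
exact: signed_square_lipschitz.
Qed.

Lemma dirichletE M f : stationary_kernel M ->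
  dirichlet M f = \sum_x w x * f x ^+ 2 - \sum_x w x * f x * apply_kernel M f x.
Proof.
move=> kM.
have lhs := sum_step_source (fun x => f x ^+ 2) kM.
have rhs := sum_step_target (fun x => f x ^+ 2) kM.
have -> : \sum_x w x * f x ^+ 2 = 2^-1 *
    (\sum_x \sum_y w x * M x y * f x ^+ 2 + \sum_x \sum_y w x * M x y * f y ^+ 2).
  by rewrite -lhs -rhs; field.
rewrite /dirichlet -[X in _ - X](mulKf (x := 2)) ?pnatr_eq0 // -mulrBr.
congr (_ * _); rewrite -big_split mulr_sumr -sumrB; apply: eq_bigr => x _ /=.
rewrite -big_split /= /apply_kernel !mulr_sumr -sumrB; apply: eq_bigr => y _.
by ring.
Qed.

Lemma sum_sqr_shift f (c : R) : \sum_x w x * f x = 0 ->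
  \sum_x w x * (f x - c) ^+ 2 = \sum_x w x * f x ^+ 2 + c ^+ 2.
Proof.
move=> f0.
transitivity (\sum_x (w x * f x ^+ 2 - 2 * c * (w x * f x) + c ^+ 2 * w x)).
  by apply: eq_bigr => x _; ring.
by rewrite big_split sumrB /= -!mulr_sumr f0 w1 mulr0 subr0 mulr1.
Qed.

(** Here M is thought of as a fast kernel, N steps of P being able to imitate
    one step of M. The displacement of F |F|, for F the function f centred at a
    median, is bounded below through M and above through the Dirichlet form of
    P. *)
Lemma mixing_poincare M P (N : R) f :
  stationary_kernel M -> stationary_kernel P ->
  (forall x, \sum_y `|M x y - w y| <= 5^-1) ->
  0 <= N -> (forall u, displacement M u <= N * displacement P u) ->
  \sum_x w x * f x = 0 ->
  \sum_x w x * f x ^+ 2 <= 100 * N ^+ 2 * dirichlet P f.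
Proof.
move=> kM kP mixM N0 cmp f0; have [c [lo hi]] := ex_median f.
pose F x := f x - c; pose u x := F x * `|F x|.
have nF : \sum_x w x * f x ^+ 2 <= \sum_x w x * F x ^+ 2.
  by rewrite sum_sqr_shift // lerDl sqr_ge0.
have dF : dirichlet P f = dirichlet P F.
  congr (_ * _); apply: eq_bigr => x _; apply: eq_bigr => y _.
  by rewrite /F; ring.
apply: le_trans nF _; rewrite dF.
have sgu x : ((u x <= 0) = (f x <= c)) * ((0 <= u x) = (c <= f x)).
  rewrite /u /F -(subr_le0 c) -(subr_ge0 c).
  have [->|h] := eqVneq (f x - c) 0; first by rewrite !mul0r; split.
  by rewrite pmulr_lle0 ?pmulr_lge0 ?normr_gt0 //; split.
have absu : \sum_x w x * `|u x| = \sum_x w x * F x ^+ 2.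
  by apply: eq_bigr => x _; rewrite normrM normr_id -expr2 real_normK ?num_real.
have below : 3 / 10 * \sum_x w x * F x ^+ 2 <= N * displacement P u.
  rewrite -absu; apply: le_trans (cmp u); apply: displacement_ge => //.
    by rewrite (eq_bigl (fun x => f x <= c)) // => x; rewrite sgu.
  by rewrite (eq_bigl (fun x => c <= f x)) // => x; rewrite sgu.
have := N0; rewrite le_eqVlt => /predU1P[N00|Npos].
  by move: below; rewrite -N00 expr0n /= mulr0 !mul0r; lra.
(* a = 10 N makes the quadratic error term 1/5 E F^2, below the 3/10 E F^2
   on the left. *)
have a0 : 0 < 10 * N by lra.
have := displacement_signed_square F kP a0.
move=> /(ler_wpM2l N0) /(le_trans below).
rewrite mulrDr [N * (2 / _ * _)]mulrA.
have -> : N * (2 / (10 * N)) = 5^-1 by field; lra.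
move=> h; rewrite [leRHS](_ : _ = 10 * (N * (10 * N * dirichlet P F))); last by ring.
by lra.
Qed.

(** * Decay of the variance under a mean of projections *)

Lemma apply_kernelM A B f x :
  apply_kernel (A *m B) f x = apply_kernel A (apply_kernel B f) x.
Proof.
rewrite /apply_kernel; under eq_bigr do rewrite mxE mulr_suml.
rewrite exchange_big; apply: eq_bigr => z _.
by rewrite mulr_sumr; apply: eq_bigr => y _; rewrite mulrA.
Qed.

Lemma apply_kernel1 f x : apply_kernel 1%:M f x = f x.
Proof.
rewrite /apply_kernel (bigD1 x) //= mxE eqxx mul1r big1 ?addr0 // => y yx.
by rewrite mxE eq_sym (negPf yx) mul0r.
Qed.

Lemma sum_apply_kernel A f : stationary_kernel A ->
  \sum_x w x * apply_kernel A f x = \sum_x w x * f x.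
Proof.
move=> [_ _ Aw]; under eq_bigr do rewrite mulr_sumr.
rewrite exchange_big; apply: eq_bigr => y _ /=.
by rewrite -Aw mulr_suml; apply: eq_bigr => x _; rewrite mulrA.
Qed.

(** A reversible idempotent kernel is an orthogonal projection of L^2(w), so
    |A f|^2 = <A f, A f> = <f, A A f> = <f, A f>. *)
Lemma norm_projection A f :
  (forall x y, w x * A x y = w y * A y x) -> A *m A = A ->
  \sum_x w x * apply_kernel A f x ^+ 2 = \sum_x w x * f x * apply_kernel A f x.
Proof.
move=> revA idA.
have AA x : apply_kernel A f x = apply_kernel A (apply_kernel A f) x.
  by rewrite -apply_kernelM idA.
transitivity (\sum_x \sum_y w x * A x y * f y * apply_kernel A f x).
  apply: eq_bigr => x _; rewrite expr2 {1}/apply_kernel mulr_suml mulr_sumr.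
  by apply: eq_bigr => y _; ring.
rewrite exchange_big; apply: eq_bigr => y _ /=.
rewrite [in RHS]AA [RHS]mulr_sumr; apply: eq_bigr => x _.
by rewrite revA; ring.
Qed.

Lemma sqr_mean_le n (a : 'I_n -> R) : (0 < n)%N ->
  (n%:R^-1 * \sum_i a i) ^+ 2 <= n%:R^-1 * \sum_i a i ^+ 2.
Proof.
move=> n0; have nR : 0 < n%:R :> R by rewrite ltr0n.
set c := n%:R^-1 * _.
have sc : \sum_i a i = n%:R * c by rewrite mulrA divff ?mul1r ?gt_eqF.
rewrite mulrC ler_pdivlMr // -subr_ge0.
suff -> : \sum_i a i ^+ 2 - c ^+ 2 * n%:R = \sum_i (a i - c) ^+ 2.
  by apply: sumr_ge0 => i _; apply: sqr_ge0.
transitivity (\sum_i (a i ^+ 2 - 2 * c * a i + c ^+ 2)).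
  rewrite big_split sumrB /= -mulr_sumr sc sumr_const card_ord -mulr_natr; ring.
by apply: eq_bigr => i _; ring.
Qed.

(** P is positive semidefinite with spectrum in [0, 1], so P^2 <= P as quadratic
    forms. Convexity of the square reduces this to the projections A i. *)
Lemma norm_projection_mean n (A : 'I_n -> 'M[R]_m) P f : (0 < n)%N ->
  P = n%:R^-1 *: \sum_i A i ->
  (forall i x y, w x * A i x y = w y * A i y x) ->
  (forall i, A i *m A i = A i) ->
  \sum_x w x * apply_kernel P f x ^+ 2 <= \sum_x w x * f x * apply_kernel P f x.
Proof.
move=> n0 defP revA idA.
have actP x : apply_kernel P f x = n%:R^-1 * \sum_i apply_kernel (A i) f x.
  rewrite /apply_kernel exchange_big mulr_sumr; apply: eq_bigr => y _.
  by rewrite defP !mxE summxE -mulr_suml mulrA.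
have -> : \sum_x w x * f x * apply_kernel P f x =
    \sum_x w x * (n%:R^-1 * \sum_i apply_kernel (A i) f x ^+ 2).
  transitivity (n%:R^-1 * \sum_i \sum_x w x * f x * apply_kernel (A i) f x).
    rewrite exchange_big mulr_sumr; apply: eq_bigr => x _.
    by rewrite actP -mulr_sumr mulrCA.
  under eq_bigr do rewrite -norm_projection //.
  rewrite exchange_big mulr_sumr; apply: eq_bigr => x _.
  by rewrite -mulr_sumr mulrCA.
by apply: ler_sum => x _; rewrite actP ler_wpM2l ?sqr_mean_le // ltW.
Qed.

(** |P g|^2 <= <g, P g> = |g|^2 - dirichlet P g <= (1 - 1/k) |g|^2 for g of
    mean zero, a class of functions that P preserves. *)
Lemma variance_contraction P (k : R) t f : stationary_kernel P ->
  (forall g, \sum_x w x * apply_kernel P g x ^+ 2 <=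
     \sum_x w x * g x * apply_kernel P g x) ->
  (forall g, \sum_x w x * g x = 0 ->
    \sum_x w x * g x ^+ 2 <= k * dirichlet P g) ->
  1 <= k -> \sum_x w x * f x = 0 ->
  \sum_x w x * apply_kernel (P ^+ t) f x ^+ 2 <= (1 - k^-1) ^+ t * \sum_x w x * f x ^+ 2.
Proof.
move=> kP posP poinc k1 f0; have k0 : 0 < k by lra.
have q0 : 0 <= 1 - k^-1 by rewrite subr_ge0 invf_le1.
elim: t => [|t IH].
  rewrite expr0 mul1r le_eqVlt; apply/orP; left; apply/eqP.
  by apply: eq_bigr => x _; rewrite apply_kernel1.
set g := apply_kernel (P ^+ t) f in IH.
have g0 : \sum_x w x * g x = 0 by rewrite sum_apply_kernel //; apply: stationary_kernelX.
have step x : apply_kernel (P ^+ t.+1) f x = apply_kernel P g x.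
  by rewrite exprS; apply: apply_kernelM.
under eq_bigr do rewrite step.
rewrite exprS -mulrA; apply: le_trans (posP g) _.
apply: le_trans (ler_wpM2l q0 IH).
have := poinc g g0; rewrite (dirichletE _ kP) -ler_pdivrMl // => h.
by rewrite mulrBl mul1r; lra.
Qed.

(** The l1 distance of row x of P from w is the value at x of P f, where f is
    the sign of that difference minus its mean under w. One point x contributes
    w x * (P f x)^2 to the variance of P f, and the variance of f is at most 1. *)
Lemma tv_le_variance P (c : R) x : stationary_kernel P ->
  (forall f, \sum_x w x * f x = 0 ->
    \sum_x w x * apply_kernel P f x ^+ 2 <= c * \sum_x w x * f x ^+ 2) -> 0 <= c ->
  w x * (\sum_y `|P x y - w y|) ^+ 2 <= c.
Proof.
move=> [P0 P1 Pw] hP c0; pose s y := Num.sg (P x y - w y).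
pose e := \sum_y w y * s y; pose f y := s y - e.
have f0 : \sum_y w y * f y = 0.
  under eq_bigr do rewrite mulrBr.
  by rewrite sumrB -mulr_suml w1 mul1r subrr.
have -> : \sum_y `|P x y - w y| = apply_kernel P f x.
  rewrite /apply_kernel; under [RHS]eq_bigr do rewrite mulrBr.
  rewrite sumrB -mulr_suml P1 mul1r -sumrB; apply: eq_bigr => y _.
  by rewrite normrEsg mulrC -mulrBl.
apply: le_trans (_ : \sum_z w z * apply_kernel P f z ^+ 2 <= _).
  rewrite (bigD1 x) //= lerDl sumr_ge0 // => y _.
  by rewrite mulr_ge0 ?sqr_ge0 // ltW.
apply: le_trans (hP f f0) _; rewrite -[leRHS]mulr1; apply: ler_wpM2l => //.
apply: le_trans (_ : \sum_y w y * s y ^+ 2 <= _).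
  have -> : \sum_y w y * s y ^+ 2 = \sum_y w y * f y ^+ 2 + e ^+ 2.
    rewrite -[e ^+ 2](sqrrN e) -(sum_sqr_shift _ f0).
    by apply: eq_bigr => y _; rewrite opprK subrK.
  by rewrite lerDl sqr_ge0.
rewrite -w1; apply: ler_sum => y _; rewrite -[leRHS]mulr1.
apply: ler_wpM2l; first exact: ltW.
by rewrite sqr_sg lern1 leq_b1.
Qed.

End Kernels.

(** * Comparison of a scan with the mean of its site updates *)

(** The l1 bounds 1/5 and 2 eps are total variation distances 1/10 and eps. If
    T = 0 the Poincare constant vanishes, hence so do all variances: the state
    space is a single point and t = 0 works. *)
Lemma scan_mixing_bounds_mean (R : realType) m (w : 'I_m -> R) n
    (A : 'I_n -> 'M[R]_m) (s : 'S_n) (T : nat) (eps p : R) :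
  (forall x, 0 < w x) -> \sum_x w x = 1 -> (0 < n)%N ->
  (forall i, stationary_kernel w (A i)) ->
  (forall i x y, w x * A i x y = w y * A i y x) ->
  (forall i, A i *m A i = A i) ->
  (forall x, \sum_y
     `|((\prod_(k < n) A (s (rev_ord k))) ^+ T) x y - w y| <= 5^-1) ->
  0 < eps -> eps <= 1 -> 0 < p -> p <= 1 -> (forall x, p <= w x) ->
  exists2 t : nat,
    t%:R <= 200 * (n%:R * T%:R) ^+ 2 * ln (1 / (eps * p)) &
    forall x, \sum_y `|((n%:R^-1 *: \sum_i A i) ^+ t) x y - w y| <= 2 * eps.
Proof.
move=> w0 w1 n0 kA revA idA mixS e0 e1 p0 p1 pw.
set S := \prod_(k < n) _ in mixS; set P := _ *: _.
have nR : 0 < n%:R :> R by rewrite ltr0n.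
have kS : stationary_kernel w S by apply: stationary_kernel_prod.
have kP : stationary_kernel w P by apply: stationary_kernel_mean.
pose N : R := n%:R * T%:R.
have N0 : 0 <= N by rewrite mulr_ge0.
have cmp u : displacement w (S ^+ T) u <= N * displacement w P u.
  apply: le_trans (displacementX w0 T u kS) _.
  rewrite [N]mulrC -mulrA; apply: ler_wpM2l => //.
  (* The factor n of N cancels the 1/n of P. *)
  rewrite displacement_mean mulVKf ?gt_eqF //.
  apply: le_trans (displacement_prod w0 _ u _) _ => //.
  rewrite le_eqVlt; apply/orP; left; apply/eqP.
  by rewrite [RHS](reindex_inj (@perm_inj _ s)) [RHS](reindex_inj rev_ord_inj).
have poinc g : \sum_x w x * g x = 0 ->
    \sum_x w x * g x ^+ 2 <= 100 * N ^+ 2 * dirichlet w P g.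
  by apply: (mixing_poincare w0 w1 (stationary_kernelX T kS)).
have posP g : \sum_x w x * apply_kernel P g x ^+ 2 <=
    \sum_x w x * g x * apply_kernel P g x.
  exact: (norm_projection_mean w0 g n0 (erefl P)).
set L := ln _.
have ep0 : 0 < eps * p by rewrite mulr_gt0.
have L0 : 0 <= L.
  by rewrite ln_ge0 // div1r invf_ge1 // -[leRHS]mulr1 ler_pM // ltW.
have [N00|Npos] := posnP (n * T)%N.
  have NN : N = 0 by rewrite /N -natrM N00.
  exists 0%N; first by rewrite mulr_ge0 ?[0 <= _ * _]mulr_ge0 ?sqr_ge0 ?ler0n.
  move=> x; have kP0 := stationary_kernelX 0 kP.
  have : w x * (\sum_y `|(P ^+ 0) x y - w y|) ^+ 2 <= 0.
    apply: tv_le_variance => // f f0; rewrite mul0r.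
    under eq_bigr do rewrite apply_kernel1.
    by move: (poinc f f0); rewrite NN expr0n /= mulr0 mul0r.
  rewrite pmulr_rle0 // => /(conj (sqr_ge0 (\sum_y `|(P ^+ 0) x y - w y|))).
  move/andP; rewrite -eq_le eq_sym sqrf_eq0 => /eqP ->.
  by rewrite mulr_ge0 // ltW.
have N1 : 1 <= N by rewrite /N -natrM ler1n.
pose k : R := 100 * N ^+ 2.
have k100 : 100 <= k by rewrite /k ler_peMr // expr_ge1.
have k0 : 0 < k by apply: lt_le_trans k100; rewrite ltr0n.
pose t := Num.truncn (2 * k * L).
have kL0 : 0 <= 2 * k * L by rewrite !mulr_ge0 // ltW.
have /andP [tle tgt] := truncn_itv kL0.
exists t.
  by apply: le_trans tle _; rewrite /k /N mulrA -natrM.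
move=> x; set D := \sum_y _.
have q0 : 4^-1 <= 1 - k^-1.
  have : k^-1 <= 100^-1 by rewrite lef_pV2 // posrE.
  by move=> h; lra.
have q1 : 0 <= 1 - k^-1 by apply: le_trans q0; rewrite invr_ge0.
have k1 : 1 <= k by apply: le_trans k100; rewrite ler1n.
have decay : w x * D ^+ 2 <= (1 - k^-1) ^+ t.
  apply: tv_le_variance => //; first exact: stationary_kernelX.
  - by move=> f f0; apply: variance_contraction.
  - exact: exprn_ge0.
(* Rounding t down costs at most a factor (1 - 1/k)^-1 <= 4. *)
have rate : (1 - k^-1) ^+ t <= 4 * (eps * p) ^+ 2.
  have step : (1 - k^-1) ^+ t.+1 <= (eps * p) ^+ 2.
    apply: le_trans (_ : expR (- k^-1) ^+ t.+1 <= _).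
      by rewrite lerXn2r ?nnegrE ?expR_ge0 ?expR_ge1Dx.
    rewrite -expRM_natr -[leRHS]lnK ?posrE ?exprn_gt0 // ler_expR lnXn //.
    have -> : ln (eps * p) = - L by rewrite /L div1r lnV ?posrE // opprK.
    rewrite mulNr mulNrn lerN2 mulrC ler_pdivlMr //.
    by rewrite [leLHS](_ : _ = 2 * k * L) ?ltW //; ring.
  rewrite -ler_pdivrMl //; apply: le_trans step.
  by rewrite exprS ler_wpM2r // exprn_ge0.
have : D ^+ 2 <= (2 * eps) ^+ 2.
  rewrite -(ler_pM2l (w0 x)); apply: le_trans decay (le_trans rate _).
  have -> : w x * (2 * eps) ^+ 2 = 4 * (eps ^+ 2 * w x) by ring.
  rewrite ler_wpM2l // exprMn ler_wpM2l ?sqr_ge0 // expr2.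
  by apply: le_trans (pw x); rewrite ger_pMr.
rewrite ler_sqr ?nnegrE //; first by apply: sumr_ge0.
by rewrite mulr_ge0 // ltW.
Qed.

(** * Mixing times *)

Section MixingTime.
Variables (R : realType) (S : finType) (q : S -> R).
Implicit Types (P : 'M[R]_#|S|) (eps : R).

Lemma mixedP P eps t : 0 <= eps ->
  reflect (forall a, \sum_b `|(P ^+ t) a b - q (enum_val b)| <= 2 * eps)
          (mixed q P eps t).
Proof.
move=> e0; have tvE x :
    (dTV (fun y => (P ^+ t) (enum_rank x) (enum_rank y)) q <= eps) =
    (\sum_b `|(P ^+ t) (enum_rank x) b - q (enum_val b)| <= 2 * eps).
  rewrite /dTV ler_pdivrMl //; congr (_ <= _).
  rewrite (big_enum_val (A := predT)) /=; apply: eq_bigr => b _.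
  by rewrite enum_valK.
apply: (iffP (bigmax_leP _ _ _ _)) => [[_ h] a|h].
  by move: (h (enum_val a) isT); rewrite tvE enum_valK.
by split=> // x _; rewrite tvE.
Qed.

Lemma mixing_time_le P eps t : mixed q P eps t ->
  (mixing_time q P eps <= t%:R%:E)%E.
Proof.
move=> h; rewrite /mixing_time; case: pselect => [ex|[]]; last by exists t.
by rewrite lee_fin ler_nat; case: ex_minnP => T _; apply.
Qed.

Variant mixing_time_spec P eps : \bar R -> Prop :=
| MixingTimeFinite T of mixed q P eps T : mixing_time_spec P eps T%:R%:E
| MixingTimeInfinite : mixing_time_spec P eps +oo%E.

Lemma mixing_timeP P eps : mixing_time_spec P eps (mixing_time q P eps).
Proof.
rewrite /mixing_time; case: pselect => [ex|_]; last by constructor.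
by case: ex_minnP => T h _; constructor.
Qed.

(** Total variation distances never exceed 1. *)
Lemma mixed0_1 P : (forall x, 0 <= q x) -> \sum_x q x = 1 -> mixed q P 1 0.
Proof.
move=> q0 q1; apply/mixedP => // a.
apply: le_trans (_ : \sum_b (`|(P ^+ 0) a b| + `|q (enum_val b)|) <= _).
  by apply: ler_sum => b _; apply: ler_normB.
rewrite big_split /= (bigD1 a) //= big1; last first.
  by move=> b ba; rewrite mxE eq_sym (negPf ba) normr0.
rewrite mxE eqxx normr1 addr0 -(big_enum_val (A := predT) (fun b => `|q b|)) /=.
by rewrite (eq_bigr q) ?q1 => [|x _]; [lra | rewrite ger0_norm].
Qed.

End MixingTime.

(** * Site updates as conditional expectations *)

Section SiteUpdates.
Variables (R : realType) (n : nat) (X : 'I_n -> finType).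
Local Notation config := {dffun forall i : 'I_n, X i}.
Variable pi : config -> R.
Hypotheses (pi_ge0 : forall x, 0 <= pi x) (pi_sum1 : \sum_x pi x = 1).

Let conf (a : 'I_#|supp pi|) : config := val (enum_val a : supp pi).
Let w a := pi (conf a).

Lemma weight_gt0 a : 0 < w a.
Proof. by rewrite lt0r pi_ge0 andbT; apply: (valP (enum_val a : supp pi)). Qed.

Lemma sum_supp (F : config -> R) : (forall z, pi z = 0 -> F z = 0) ->
  \sum_a F (conf a) = \sum_z F z.
Proof.
move=> F0.
rewrite -(big_enum_val (A := predT) (fun z : supp pi => F (val z))) /=.
rewrite [RHS](bigID (fun z => pi z != 0)) /= [X in _ + X]big1 ?addr0; last first.
  by move=> z /negPn /eqP /F0.
by rewrite (big_sub [pred z | pi z != 0]).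
Qed.

Lemma sum_weight : \sum_a w a = 1.
Proof. by rewrite (sum_supp (F := pi)). Qed.

Lemma agree_offP i (x y : config) :
  reflect (forall j, j != i -> x j = y j) (agree_off i x y).
Proof.
apply: (iffP forallP) => h j; first by move=> ji; apply/eqP/(implyP (h j)).
by apply/implyP => /h ->.
Qed.

Lemma agree_off_refl i (x : config) : agree_off i x x.
Proof. exact/agree_offP. Qed.

Lemma agree_off_sym i (x y : config) : agree_off i x y = agree_off i y x.
Proof. by apply/agree_offP/agree_offP => h j /h. Qed.

Lemma agree_off_trans i (x y z : config) :
  agree_off i x y -> agree_off i y z = agree_off i x z.
Proof.
move=> /agree_offP h; apply/agree_offP/agree_offP => k j ji.
  by rewrite h // k.
by rewrite -h // k.
Qed.

Let fiber i x := \sum_(z : config | agree_off i x z) pi z.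

Lemma fiber_agree i (x y : config) : agree_off i x y -> fiber i y = fiber i x.
Proof. by move=> h; apply: eq_bigl => z; apply: agree_off_trans. Qed.

Lemma fiber_gt0 i a : 0 < fiber i (conf a).
Proof.
rewrite /fiber (bigD1 (conf a)) ?agree_off_refl //= ltr_wpDr ?sumr_ge0 //.
exact: weight_gt0.
Qed.

Lemma site_updateE i a b : site_update pi i a b =
  if agree_off i (conf a) (conf b) then w b / fiber i (conf a) else 0.
Proof. by rewrite mxE. Qed.

Lemma site_update_reversible i a b :
  w a * site_update pi i a b = w b * site_update pi i b a.
Proof.
rewrite !site_updateE [agree_off i (conf b) _]agree_off_sym.
by case: ifP => [/fiber_agree ->|_]; [rewrite mulrCA | rewrite !mulr0].
Qed.

Lemma site_update_sum1 i a : \sum_b site_update pi i a b = 1.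
Proof.
under eq_bigr do rewrite site_updateE.
rewrite (sum_supp (F := fun z => if agree_off i (conf a) z
   then pi z / fiber i (conf a) else 0)); last first.
  by move=> z ->; rewrite mul0r if_same.
by rewrite -big_mkcond -mulr_suml divff // gt_eqF ?fiber_gt0.
Qed.

Lemma site_update_stationary i : stationary_kernel w (site_update pi i).
Proof.
split=> [a b|a|b]; last 2 first.
- exact: site_update_sum1.
- under eq_bigr do rewrite site_update_reversible.
  by rewrite -mulr_sumr site_update_sum1 mulr1.
rewrite site_updateE; case: ifP => // _.
by rewrite divr_ge0 ?pi_ge0 // ltW ?fiber_gt0.
Qed.

(** The second update resamples from the conditional law given the same
    off-site coordinates, so its row does not depend on the result of the
    first one. *)
Lemma site_update_idem i :
  site_update pi i *m site_update pi i = site_update pi i.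
Proof.
apply/matrixP => a c; rewrite mxE -[RHS]mul1r -(site_update_sum1 i a) mulr_suml.
apply: eq_bigr => b _; rewrite !site_updateE.
case: ifP => [ab|_]; last by rewrite !mul0r.
by rewrite (agree_off_trans _ ab) (fiber_agree ab).
Qed.

Lemma pi_min_gt0 : 0 < pi_min pi.
Proof.
by apply: lt_bigmin => // x pix; rewrite lt0r pix pi_ge0.
Qed.

Lemma pi_min_le1 : pi_min pi <= 1.
Proof. exact: bigmin_le_id. Qed.

Lemma pi_min_le a : pi_min pi <= w a.
Proof. by apply: bigmin_le_cond; apply: (valP (enum_val a : supp pi)). Qed.

Lemma tmix_GD_le (s : 'S_n) (T : nat) (eps : R) : (0 < n)%N ->
  0 < eps -> eps <= 1 ->
  mixed (supp_distr (pi := pi)) (systematic_scan pi s) (1 / 10) T ->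
  (tmix_GD pi eps <=
     (200 * (n%:R * T%:R) ^+ 2 * ln (1 / (eps * pi_min pi)))%:E)%E.
Proof.
have tenth : 0 <= 1 / 10 :> R by lra.
move=> n0 e0 e1 /(mixedP _ _ _ tenth) mixS.
have [] := @scan_mixing_bounds_mean R _ w n (site_update pi) s T eps (pi_min pi).
- exact: weight_gt0.
- exact: sum_weight.
- exact: n0.
- exact: site_update_stationary.
- exact: site_update_reversible.
- exact: site_update_idem.
- move=> a; apply: le_trans (mixS a) _; lra.
- exact: e0.
- exact: e1.
- exact: pi_min_gt0.
- exact: pi_min_le1.
- exact: pi_min_le.
move=> t tle mixt; apply: le_trans (mixing_time_le (t := t) _) _.
  by apply/mixedP; [exact: ltW | exact: mixt].
by rewrite lee_fin.
Qed.

Lemma tmix_GD_1 : (tmix_GD pi 1 <= 0)%E.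
Proof.
apply: (mixing_time_le (t := 0%N)); apply: mixed0_1 => [x|]; first exact: pi_ge0.
rewrite -(big_sub [pred z | pi z != 0]) /= -pi_sum1.
rewrite [RHS](bigID (fun z => pi z != 0)) /=.
by rewrite [X in _ + X]big1 ?addr0 // => z /negPn /eqP.
Qed.

(** (n T)^2 <= n^k T^4 and the logarithmic factor of Phi is at least 1. If the
    scan never mixes, the right-hand side is infinite unless the final
    logarithm vanishes (by the convention oo * 0 = 0); it vanishes only for
    eps = 1, when Glauber dynamics is mixed at time 0. *)
Lemma tmix_GD_le_Phi (s : 'S_n) (k : nat) (eps : R) : (0 < n)%N ->
  0 < eps -> eps <= 1 -> (2 <= k)%N ->
  (tmix_GD pi eps <=
     ePhi 200 ((n%:R ^+ k)%R%:E * (tmix_SS pi s (1 / 10)%R) ^+ 4)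
     * (ln (1 / (eps * pi_min pi)))%R%:E)%E.
Proof.
move=> n0 e0 e1 k2.
have nR : 1 <= n%:R :> R by rewrite ler1n.
have ep0 : 0 < eps * pi_min pi by rewrite mulr_gt0 // pi_min_gt0.
have ep1 : eps * pi_min pi <= 1.
  by rewrite -[leRHS]mulr1 ler_pM ?pi_min_le1 // ltW ?pi_min_gt0.
have L0 : 0 <= ln (1 / (eps * pi_min pi)).
  by rewrite ln_ge0 // div1r invf_ge1.
rewrite /tmix_SS; case: mixing_timeP => [T mixT|].
  apply: le_trans (tmix_GD_le n0 e0 e1 mixT) _.
  rewrite -EFin_expe -EFinM lee_fin; apply: ler_wpM2r => //.
  set x := n%:R ^+ k * T%:R ^+ 4.
  have x0 : 0 <= x by rewrite mulr_ge0 ?exprn_ge0.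
  have xge : (n%:R * T%:R) ^+ 2 <= x.
    rewrite exprMn /x; apply: ler_pM; rewrite ?exprn_ge0 //.
      exact: ler_weXn2l.
    rewrite -!natrX ler_nat; case: (T) => // T'; exact: leq_pexp2l.
  have ln1 : 1 <= ln (expR 1 + x).
    rewrite -[leLHS]expRK ler_ln ?posrE ?expR_gt0 ?lerDl //.
    by rewrite ltr_wpDr ?expR_gt0.
  rewrite /Phi; apply: le_trans (_ : 200 * x * 1 <= _).
    by rewrite mulr1; apply: ler_wpM2l; first exact: ler0n.
  apply: ler_wpM2l; first by rewrite mulr_ge0 ?ler0n.
  by apply: le_trans ln1 (le1r_powR ln1 _); rewrite ler1n.
have -> : ((n%:R ^+ k)%R%:E * (+oo%E : \bar R) ^+ 4 = +oo)%E.
  by rewrite !expeS expe0 mule1 !mulyy gt0_muley // lte_fin exprn_gt0 // ltr0n.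
rewrite /=; move: L0; rewrite le_eqVlt => /predU1P [L0|L0]; last first.
  by rewrite gt0_mulye ?lte_fin // leey.
rewrite -L0 mule0.
have e1' : eps = 1.
  apply/eqP; rewrite eq_le e1 /=; have : eps * pi_min pi = 1.
    by apply: invr_inj; rewrite invr1 -div1r -[LHS]lnK ?posrE ?divr_gt0 // -L0 expR0.
  by move=> <-; rewrite ger_pMr // pi_min_le1.
by rewrite e1' tmix_GD_1.
Qed.

End SiteUpdates.

Theorem corollary3p3 (R : realType) :
  exists C : R, 0 < C /\
  forall (eps : R) (n : nat) (X : 'I_n -> finType)
         (pi : {dffun forall i : 'I_n, X i} -> R),
    0 < eps -> eps <= 1 ->
    (1 <= n)%N ->
    (forall x, 0 <= pi x) -> \sum_x pi x = 1 ->
    (tmix_GD pi eps <=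
       (\big[maxe/-oo]_(s : 'S_n)
          ePhi C ((n%:R ^+ 4)%R%:E * (tmix_SS pi s (1 / 10)%R) ^+ 4))
       * (ln (1 / (eps * pi_min pi)))%R%:E)%E /\
    (tmix_GD pi eps <=
       (\big[mine/+oo]_(s : 'S_n)
          ePhi C ((n%:R ^+ 6)%R%:E * (tmix_SS pi s (1 / 10)%R) ^+ 4))
       * (ln (1 / (eps * pi_min pi)))%R%:E)%E.
Proof.
(* 200 = 2 * 100: twice the constant of the Poincare inequality. *)
exists 200; split=> [|eps n X pi e0 e1 n0 pi0 pi1]; first by rewrite ltr0n.
have L0 : 0 <= ln (1 / (eps * pi_min pi)).
  rewrite ln_ge0 // div1r invf_ge1 ?mulr_gt0 ?pi_min_gt0 //.
  by rewrite -[leRHS]mulr1 ler_pM ?pi_min_le1 // ltW ?pi_min_gt0.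
split.
  apply: le_trans (tmix_GD_le_Phi pi0 pi1 1%g n0 e0 e1 (isT : 2 <= 4)%N) _.
  by apply: lee_wpmul2r; [rewrite lee_fin | exact: le_bigmax].
pose F s := ePhi 200 ((n%:R ^+ 6)%R%:E * (tmix_SS pi s (1 / 10)%R) ^+ 4)%E.
have [s _ ->] := @eq_bigmin _ _ _ _ (1%g : 'S_n) xpredT F isT (fun _ _ => leey _).
exact: tmix_GD_le_Phi.
Qed.
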